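(* Let $a>0$, $\lambda>0$. The quadratic program $$\min_{\beta,g,h\in\mathbb R^d}\ \tfrac12\Big(\beta^\top Q\beta+\frac nag^\top g-\frac{2n}ag^\top h\Big)+n\lambda\mathbf 1^\top h+q^\top\beta$$ $$\text{s.t.}\quad\beta\in\Lambda;\quad h\ge\beta;\quad h\ge-\beta;\quad0\le g\le a\lambda$$ is equivalent to the following linear program with complementarity constraints: $$\min\ \tfrac12q^\top\beta-\tfrac12\mathbf b^\top\rho-\tfrac12a\lambda\mathbf 1^\top\eta_4+\tfrac12\lambda n\mathbf 1^\top h$$ $$\text{s.t.}\quad\begin{cases}Q\beta+q+\eta_1-\eta_2+\mathcal A\rho=0,\\ \frac nag-\frac nah-\eta_3+\eta_4=0;\quad-n\big(\frac1ag-\lambda\mathbf 1\big)-\eta_1-\eta_2=0,\\ 0\le\eta_1\perp h-\beta\ge0;\quad0\le\eta_2\perp h+\beta\ge0,\\ 0\le\eta_3\perp g\ge0;\quad0\le\eta_4\perp a\lambda\mathbf 1-g\ge0,\\ 0\le\rho\perp\mathbf b-\mathcal A^\top\beta\ge0,\\ \beta,g,h,\eta_1,\eta_2,\eta_3,\eta_4\in\mathbb R^d;\quad\rho\in\mathbb R^m,\end{cases}$$ i.e. $(\beta,g,h)$ is a global minimizer of the quadratic program if and only if there exist $\eta_1,\eta_2,\eta_3,\eta_4\in\mathbb R^d$ and $\rho\in\mathbb R^m$ such that $(\beta,g,h,\eta_1,\eta_2,\eta_3,\eta_4,\rho)$ is a global minimizer of the complementarity program.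
   Context: Setting: $n\ge1$ is the sample size, $d\ge1$ the dimension, $0\le m<d$; $Q\in\mathbb R^{d\times d}$ is symmetric (not necessarily positive semidefinite), $q\in\mathbb R^d$, $\mathcal A\in\mathbb R^{d\times m}$ has full rank, $\mathbf b\in\mathbb R^m$, and $\Lambda:=\{\beta\in\mathbb R^d:\mathcal A^\top\beta\le\mathbf b\}$ is nonempty. $\mathbf 1$ is the all-ones vector; vector inequalities are componentwise. For vectors $\Phi=(\phi_i)$, $\Delta=(\delta_i)$ of the same dimension, $0\le\Phi\perp\Delta\ge0$ means $\phi_i\ge0$, $\delta_i\ge0$ and $\phi_i\delta_i=0$ for all $i$. Standing assumption: the MCP penalized problem $\min_{\beta\in\Lambda}\tfrac12\beta^\top Q\beta+q^\top\beta+n\sum_{i=1}^dP_{\mathrm{MCP},\lambda}(|\beta_i|)$ has a finite global solution, where $P_{\mathrm{MCP},\lambda}(\theta)=\int_0^\theta\frac{(a\lambda-t)_+}{a}\,dt$ for $\theta\ge0$ and $(b)_+=\max\{b,0\}$. *)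

(* Defs.v *)
From HB Require Import structures.
From mathcomp Require Import all_boot all_order all_algebra.
From mathcomp Require Import all_classical all_reals all_analysis.

Set Implicit Arguments.
Unset Strict Implicit.
Unset Printing Implicit Defensive.

Import Order.TTheory GRing.Theory Num.Theory.

Local Open Scope classical_set_scope.
Local Open Scope ring_scope.

Section Definitions.
Variable R : realType.

Definition dotcv k (u v : 'cV[R]_k) : R := (u^T *m v) 0 0.

Definition onescv k : 'cV[R]_k := const_mx 1.

Definition lecv k (u v : 'cV[R]_k) : Prop := forall i, u i 0 <= v i 0.

(* 0 <= Phi _|_ Delta >= 0 *)
Definition complementary k (Phi Delta : 'cV[R]_k) : Prop :=
  forall i, [/\ 0 <= Phi i 0, 0 <= Delta i 0 & Phi i 0 * Delta i 0 = 0].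

Definition is_global_minimizer (T : Type) (F : set T) (f : T -> R) (x : T) :
    Prop :=
  F x /\ forall y, F y -> f x <= f y.

(* Only meaningful for 0 <= theta: the interval is empty otherwise. *)
Definition mcp (a lambda theta : R) : R :=
  \int[lebesgue_measure]_(t in `[0, theta]) (Num.max (a * lambda - t) 0 / a).

Definition polyhedron d m (A : 'M[R]_(d, m)) (b : 'cV[R]_m) : set 'cV[R]_d :=
  [set beta | lecv (A^T *m beta) b].

Definition mcp_objective d (n : nat) (Q : 'M[R]_d) (q : 'cV[R]_d)
    (a lambda : R) (beta : 'cV[R]_d) : R :=
  2^-1 * dotcv beta (Q *m beta) + dotcv q beta
  + n%:R * \sum_(i < d) mcp a lambda `|beta i 0|.

(* (beta, g, h) *)
Definition qp_point d : Type := ('cV[R]_d * 'cV[R]_d * 'cV[R]_d)%type.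

Definition qp_objective d (n : nat) (Q : 'M[R]_d) (q : 'cV[R]_d)
    (a lambda : R) (x : qp_point d) : R :=
  let '(beta, g, h) := x in
  2^-1 * (dotcv beta (Q *m beta) + n%:R / a * dotcv g g
          - 2 * n%:R / a * dotcv g h)
  + n%:R * lambda * dotcv (onescv d) h + dotcv q beta.

Definition qp_feasible d m (A : 'M[R]_(d, m)) (b : 'cV[R]_m)
    (a lambda : R) : set (qp_point d) :=
  [set x | let '(beta, g, h) := x in
    [/\ polyhedron A b beta,
        lecv beta h,
        lecv (- beta) h,
        lecv 0 g
      & lecv g ((a * lambda) *: onescv d)]].

(* (beta, g, h, eta1, eta2, eta3, eta4, rho) *)
Definition lpcc_point d m : Type :=
  ('cV[R]_d * 'cV[R]_d * 'cV[R]_d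
   * 'cV[R]_d * 'cV[R]_d * 'cV[R]_d * 'cV[R]_d * 'cV[R]_m)%type.

Definition lpcc_objective d m (n : nat) (q : 'cV[R]_d) (b : 'cV[R]_m)
    (a lambda : R) (x : lpcc_point d m) : R :=
  let '(beta, g, h, eta1, eta2, eta3, eta4, rho) := x in
  2^-1 * dotcv q beta - 2^-1 * dotcv b rho
  - 2^-1 * a * lambda * dotcv (onescv d) eta4
  + 2^-1 * lambda * n%:R * dotcv (onescv d) h.

Definition lpcc_feasible d m (n : nat) (Q : 'M[R]_d) (q : 'cV[R]_d)
    (A : 'M[R]_(d, m)) (b : 'cV[R]_m) (a lambda : R) :
    set (lpcc_point d m) :=
  [set x | let '(beta, g, h, eta1, eta2, eta3, eta4, rho) := x in
    [/\ Q *m beta + q + eta1 - eta2 + A *m rho = 0,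
        (n%:R / a) *: g - (n%:R / a) *: h - eta3 + eta4 = 0
      & - (n%:R *: (a^-1 *: g - lambda *: onescv d)) - eta1 - eta2 = 0]
    /\
    [/\ complementary eta1 (h - beta),
        complementary eta2 (h + beta),
        complementary eta3 g,
        complementary eta4 ((a * lambda) *: onescv d - g)
      & complementary rho (b - A^T *m beta)]].

End Definitions.

(* Main.v *)
Require Import Defs.
From mathcomp Require Import all_boot all_order all_algebra.
From mathcomp Require Import all_classical all_reals all_analysis.
From mathcomp Require Import ring lra.

Import Order.TTheory GRing.Theory Num.Theory.
Local Open Scope classical_set_scope.
Local Open Scope ring_scope.

(** The complementarity program is the KKT system of the quadratic program,
    with the quadratic objective replaced by a linear one.

    Three facts make the two programs equivalent.
    - At a KKT point the objectives agree ([lpcc_objectiveE]).  Writing the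
      quadratic program as min x^T H x / 2 + c^T x subject to G x <= r,
      stationarity H x + c + G^T u = 0 gives x^T H x = - c^T x - u^T G x,
      and complementarity gives u^T G x = u^T r, so the value is
      (c^T x - u^T r) / 2, which is linear in (x, u).
    - A global minimizer of the quadratic program is a KKT point
      ([lpcc_multipliers]).  All constraints are affine, so every direction
      allowed by the active ones is feasible for a short time, and the Farkas
      lemma turns first-order optimality into multipliers ([kkt]).
    - The quadratic program attains its minimum ([qp_solvable]).  Minimizing
      over (g, h) with beta fixed produces the MCP penalty, because
      P(theta) is the minimum of g^2 / (2 a) - g h / a + lambda h over
      h >= theta and 0 <= g <= a lambda ([mcp_le_envelope],
      [mcp_envelope_attained]).  Hence a solution of the penalized problem
      lifts to one of the quadratic program.

    The first two facts show that a minimizer of the quadratic program, with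
    its multipliers, minimizes the complementarity program.  Conversely, a
    minimizer of the complementarity program does at least as well as every
    KKT point, and the third fact says that one of these KKT points attains
    the minimum of the quadratic program. *)

(** * Farkas lemma and optimality conditions under affine constraints *)

(** Bartl's proof, by induction on the functionals.  If those in the tail do
    not suffice, some [z] satisfies them while [gamma z > 0], and then
    [alpha j z > 0] for the head [j].  Projecting along [z] onto the kernel of [alpha j] removes that functional
    from the list; its multiplier is then read off at [z], and its sign comes
    from the sign conditions on [z].  Functionals are plain functions on an
    arbitrary module, so that constraints on tuples of vectors need no block
    matrices. *)
Lemma farkas {R : realFieldType} {W : lmodType R} {I : eqType}
    (s : seq I) (alpha : I -> W -> R) (gamma : W -> R) :
  uniq s -> (forall i, scalar (alpha i)) -> scalar gamma ->
  (forall x, (forall i, i \in s -> alpha i x <= 0) -> gamma x <= 0) ->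
  exists2 u : I -> R, forall i, 0 <= u i &
    forall x, gamma x = \sum_(i <- s) u i * alpha i x.
Proof.
elim: s alpha gamma => [|j s IHs] alpha gamma /=.
  move=> _ _ lin_gamma gamma_le0; exists (fun=> 0) => // x.
  have gammaN : gamma (- x) = - gamma x.
    have := lin_gamma (-1) x 0; have := lin_gamma 1 0 0.
    by rewrite scale1r !addr0 mul1r scaleN1r; lra.
  have := gamma_le0 x; have := gamma_le0 (- x); rewrite gammaN big_nil.
  move=> lex gex; apply/eqP; rewrite eq_le gex //=.
  by rewrite -oppr_le0 lex.
move=> /andP[j_notin_s uniq_s] lin_alpha lin_gamma gamma_le0.
have [gamma_le0s|] := EM (forall x,
    (forall i, i \in s -> alpha i x <= 0) -> gamma x <= 0).
  have [u u_ge0 gammaE] := IHs alpha gamma uniq_s lin_alpha lin_gamma gamma_le0s.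
  exists (fun i => if i == j then 0 else u i) => [i|x].
    by case: ifP.
  rewrite big_cons eqxx mul0r add0r gammaE; apply: eq_big_seq => i i_in_s.
  by case: eqP => // ij; rewrite -ij i_in_s in j_notin_s.
move=> /existsNP[z /not_implyP[alphaz_le0 /negP]]; rewrite -ltNge => gammaz_gt0.
have alphajz_gt0 : 0 < alpha j z.
  rewrite ltNge; apply/negP => alphajz_le0.
  move: gammaz_gt0; rewrite ltNge => /negP; apply; apply: gamma_le0 => i.
  by rewrite in_cons => /predU1P[->//|/alphaz_le0].
(* [proj f x] is the value of [f] at the projection of [x] onto the kernel
   of [alpha j] along [z]. *)
pose proj f (x : W) : R := f x - alpha j x / alpha j z * f z.
have lin_proj f : scalar f -> scalar (proj f).
  by move=> lin_f t x y; rewrite /proj !lin_f lin_alpha; ring.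
have projE f x : scalar f -> proj f x = f (- (alpha j x / alpha j z) *: z + x).
  by move=> lin_f; rewrite lin_f /proj; ring.
have [|u u_ge0 projgammaE] :=
    IHs (fun i => proj (alpha i)) (proj gamma) uniq_s
        (fun i => lin_proj _ (lin_alpha i)) (lin_proj _ lin_gamma).
  move=> x projalpha_le0; rewrite projE //; apply: gamma_le0 => i.
  rewrite in_cons => /predU1P[->|i_in_s]; last first.
    by rewrite -projE //; exact: projalpha_le0.
  by rewrite lin_alpha mulNr divfK ?gt_eqF// addrC subrr.
(* The only value for which the decomposition of [gamma] is exact at [z]. *)
pose uj := (gamma z - \sum_(i <- s) u i * alpha i z) / alpha j z.
exists (fun i => if i == j then uj else u i) => [i|x].
  case: ifP => // _; rewrite divr_ge0 ?ltW// subr_gt0 (le_lt_trans _ gammaz_gt0)//.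
  rewrite big_seq; apply: sumr_le0 => k k_in_s.
  by rewrite mulr_ge0_le0 // alphaz_le0.
rewrite big_cons eqxx.
have -> : \sum_(i <- s) (if i == j then uj else u i) * alpha i x =
          \sum_(i <- s) u i * alpha i x.
  apply: eq_big_seq => i i_in_s.
  by case: eqP => // ij; rewrite -ij i_in_s in j_notin_s.
have := projgammaE x; rewrite /proj => /(canRL (subrK _)) ->.
have -> : \sum_(i <- s) u i * (alpha i x - alpha j x / alpha j z * alpha i z) =
  \sum_(i <- s) u i * alpha i x -
    alpha j x / alpha j z * \sum_(i <- s) u i * alpha i z.
  rewrite mulr_sumr -sumrB; apply: eq_bigr => i _; ring.
by rewrite /uj; field; rewrite gt_eqF.
Qed.

Lemma small_step {R : realFieldType} {I : eqType} (s : seq I) (p r : I -> R) :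
  (forall i, 0 < r i) ->
  exists2 t : R, 0 < t & forall i, i \in s -> t * p i <= r i.
Proof.
move=> r_gt0; elim: s => [|j s [t t_gt0 t_ok]]; first by exists 1.
have den_gt0 : 0 < 1 + `|p j| by rewrite ltr_pwDl.
have min_gt0 : 0 < Num.min t (r j / (1 + `|p j|)).
  by rewrite lt_min t_gt0 divr_gt0.
exists (Num.min t (r j / (1 + `|p j|))) => // i; rewrite in_cons => /predU1P[->|i_in_s].
  have le1 : Num.min t (r j / (1 + `|p j|)) <= r j / (1 + `|p j|).
    by rewrite ge_min lexx orbT.
  rewrite ler_pdivlMr // in le1; apply: le_trans le1.
  rewrite ler_wpM2l ?ltW//; have := ler_norm (p j); lra.
have [p_ge0|p_lt0] := leP 0 (p i).
  by apply: le_trans (t_ok i i_in_s); rewrite ler_wpM2r// ge_min lexx.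
by apply: ltW; apply: lt_trans (r_gt0 i); rewrite pmulr_rlt0.
Qed.

(** A direction that does not leave the active constraints stays feasible for
    a short time, since finitely many inactive constraints have positive
    slack.  The first-order term [gamma] is therefore nonnegative along it,
    whatever the sign of the curvature [kappa], and the Farkas lemma applied
    to the active constraints gives the multipliers. *)
Lemma kkt {R : realType} {W : lmodType R} {I : finType}
    (alpha : I -> W -> R) (r : I -> R) (f gamma kappa : W -> R) (x : W) :
  (forall i, scalar (alpha i)) -> scalar gamma ->
  (forall y t, f (t *: y + x) = f x + t * gamma y + t ^+ 2 * kappa y) ->
  is_global_minimizer [set z | forall i, alpha i z <= r i] f x ->
  exists u : I -> R,
    [/\ forall i, 0 <= u i, forall i, u i * (r i - alpha i x) = 0
      & forall y, gamma y + \sum_i u i * alpha i y = 0].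
Proof.
move=> lin_alpha lin_gamma f_expand [/= x_feas x_min].
pose active := [pred i | alpha i x == r i].
have gamma_ge0 y :
    (forall i, i \in enum active -> alpha i y <= 0) -> - gamma y <= 0.
  move=> alphay_le0; rewrite oppr_le0 leNgt; apply/negP => gammay_lt0.
  (* [Some i] bounds the step by constraint [i]; [None] makes it short enough
     for the first-order decrease to dominate the curvature. *)
  pose p k := if k is Some i then alpha i y else kappa y.
  pose slack (k : option I) := if k is Some i then
      (if active i then 1 else r i - alpha i x) else - gamma y / 2.
  have slack_gt0 k : 0 < slack k.
    case: k => [i|] /=; last by lra.
    by case: eqP => [//|/eqP]; rewrite subr_gt0 lt_neqAle x_feas andbT.
  have [t t_gt0 t_ok] := small_step (enum {: option I}) p slack slack_gt0.
  have : f x <= f (t *: y + x).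
    apply: x_min => i /=; rewrite lin_alpha.
    have := t_ok (Some i); rewrite mem_enum => /(_ isT) /=.
    case: eqP => [act _|_]; last by rewrite lerBrDr.
    rewrite -act gerDr pmulr_rle0 //.
    by apply: alphay_le0; rewrite mem_enum inE act.
  rewrite f_expand.
  have := t_ok None; rewrite mem_enum => /(_ isT) /= kappa_le.
  have : t * (t * kappa y) <= t * (- gamma y / 2) by rewrite ler_pM2l.
  have : t * gamma y < 0 by rewrite pmulr_rlt0.
  rewrite expr2; lra.
have lin_Ngamma : scalar (fun y => - gamma y).
  by move=> t y z; rewrite lin_gamma; ring.
have [u u_ge0 gammaE] :=
  farkas (enum active) alpha _ (enum_uniq _) lin_alpha lin_Ngamma gamma_ge0.
exists (fun i => if active i then u i else 0); split => [i|i|y].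
- by case: ifP.
- by rewrite /=; case: eqP => [->|_]; rewrite ?mul0r // subrr mulr0.
- rewrite -(opprK (gamma y)) gammaE big_enum big_mkcond /= addrC.
  apply/eqP; rewrite subr_eq0; apply/eqP/eq_bigr => i _.
  by rewrite inE; case: ifP; rewrite ?mul0r.
Qed.

(** * The MCP penalty as a partial minimum *)

Section McpClosedForm.
Import numFieldNormedType.Exports.

(** The integrand vanishes past [a * lambda], so the integral may be cut at
    [Num.min theta (a * lambda)], below which the positive part is the
    identity. *)
Lemma mcpE {R : realType} (a lambda theta : R) :
  0 < a -> 0 < lambda -> 0 <= theta ->
  mcp a lambda theta =
    lambda * Num.min theta (a * lambda) - (Num.min theta (a * lambda)) ^+ 2 / (2 * a).
Proof.
move=> a_gt0 lambda_gt0 theta_ge0; rewrite /mcp.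
set u := Num.min _ _.
have u_ge0 : 0 <= u by rewrite le_min theta_ge0 mulr_ge0 // ltW.
pose f t : R := (a * lambda - t) / a.
have -> : \int[lebesgue_measure]_(t in `[0, theta])
            (Num.max (a * lambda - t) 0 / a)
        = \int[lebesgue_measure]_(t in `[0, u]) f t.
  rewrite Rintegral_mkcond [RHS]Rintegral_mkcond; congr Rintegral.
  apply/funext => t; rewrite /patch !mem_setE !in_itv /= /u le_min /f.
  have [t_ge0|] //= := leP 0 t.
  have [t_le|t_gt] := leP t theta; last by [].
  rewrite /=; have [t_le'|t_gt'] := leP t (a * lambda).
    by rewrite max_l // subr_ge0.
  by rewrite max_r ?mul0r // subr_le0 ltW.
have [u0|u_neq0] := eqVneq u 0.
  by rewrite u0 set_itv1 Rintegral_set1; ring.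
have u_gt0 : 0 < u by rewrite lt0r u_neq0.
pose F t : R := lambda * t - t ^+ 2 / (2 * a).
have dF t : is_derive t (1 : R) F (f t).
  rewrite /F /f; apply: is_derive_eq.
  rewrite /GRing.scale /=; field; rewrite gt_eqF //.
have cF : continuous F.
  by move=> t; apply: differentiable_continuous; apply/derivable1_diffP.
have cf : continuous f.
  move=> t; rewrite /f; apply: cvgM; last exact: cvg_cst.
  by apply: cvgB; [exact: cvg_cst|exact: cvg_id].
rewrite /Rintegral (@continuous_FTC2 _ f F) //.
- by rewrite /= /F; ring.
- exact: continuous_subspaceT.
- split=> [//||]; first by apply: cvg_at_right_filter; exact: cF.
  by apply: cvg_at_left_filter; exact: cF.
- by move=> t _; rewrite derive1E; exact: derive_val.
Qed.

End McpClosedForm.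

(** With u = min(theta, a lambda), the gap equals
    (g - u)^2 / (2 a) + (a lambda - g) (h - u) / a. *)
Lemma mcp_le_envelope {R : realType} (a lambda theta g h : R) :
  0 < a -> 0 < lambda -> 0 <= theta -> theta <= h -> 0 <= g -> g <= a * lambda ->
  mcp a lambda theta <= g ^+ 2 / (2 * a) - g * h / a + lambda * h.
Proof.
move=> a_gt0 lambda_gt0 theta_ge0 theta_le_h g_ge0 g_le.
rewrite mcpE //; set u := Num.min _ _.
have u_le : u <= h by rewrite (le_trans _ theta_le_h) // ge_min lexx.
rewrite -subr_ge0.
have -> : g ^+ 2 / (2 * a) - g * h / a + lambda * h -
    (lambda * u - u ^+ 2 / (2 * a)) =
    (g - u) ^+ 2 / (2 * a) + (a * lambda - g) * (h - u) / a.
  by field; rewrite gt_eqF.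
rewrite addr_ge0 // divr_ge0 ?sqr_ge0 ?mulr_ge0 ?subr_ge0 // ltW //.
Qed.

Lemma mcp_envelope_attained {R : realType} (a lambda theta : R) :
  0 < a -> 0 < lambda -> 0 <= theta ->
  let g := Num.min theta (a * lambda) in
  g ^+ 2 / (2 * a) - g * theta / a + lambda * theta = mcp a lambda theta.
Proof.
move=> a_gt0 lambda_gt0 theta_ge0 g; rewrite mcpE // -/g.
have a_neq0 : a != 0 by rewrite gt_eqF.
suff : (a * lambda - g) * (theta - g) = 0.
  move=> prod0; apply/eqP; rewrite -subr_eq0.
  have -> : g ^+ 2 / (2 * a) - g * theta / a + lambda * theta -
      (lambda * g - g ^+ 2 / (2 * a)) = (a * lambda - g) * (theta - g) / a.
    by field.
  by rewrite prod0 mul0r.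
by rewrite /g; case: leP => _; rewrite subrr ?mul0r ?mulr0.
Qed.

(** * The bilinear form on column vectors *)

Section Dot.
Context {R : realType}.

Lemma dotcvE {k} (u v : 'cV[R]_k) : dotcv u v = \sum_i u i 0 * v i 0.
Proof. by rewrite /dotcv mxE; apply: eq_bigr => i _; rewrite mxE. Qed.

Lemma dotcvC {k} (u v : 'cV[R]_k) : dotcv u v = dotcv v u.
Proof. by rewrite !dotcvE; apply: eq_bigr => i _; rewrite mulrC. Qed.

Lemma dotcvDr {k} (u v w : 'cV[R]_k) : dotcv u (v + w) = dotcv u v + dotcv u w.
Proof. by rewrite /dotcv mulmxDr mxE. Qed.

Lemma dotcvZr {k} c (u v : 'cV[R]_k) : dotcv u (c *: v) = c * dotcv u v.
Proof. by rewrite /dotcv -scalemxAr mxE. Qed.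

Lemma dotcvNr {k} (u v : 'cV[R]_k) : dotcv u (- v) = - dotcv u v.
Proof. by rewrite -scaleN1r dotcvZr mulN1r. Qed.

Lemma dotcv0r {k} (u : 'cV[R]_k) : dotcv u 0 = 0.
Proof. by rewrite /dotcv mulmx0 mxE. Qed.

Lemma dotcvDl {k} (u v w : 'cV[R]_k) : dotcv (u + v) w = dotcv u w + dotcv v w.
Proof. by rewrite dotcvC dotcvDr !(dotcvC w). Qed.

Lemma dotcvZl {k} c (u v : 'cV[R]_k) : dotcv (c *: u) v = c * dotcv u v.
Proof. by rewrite dotcvC dotcvZr dotcvC. Qed.

Lemma dotcvNl {k} (u v : 'cV[R]_k) : dotcv (- u) v = - dotcv u v.
Proof. by rewrite dotcvC dotcvNr dotcvC. Qed.

Definition dotcv_lin :=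
  (@dotcvDl, @dotcvDr, @dotcvNl, @dotcvNr, @dotcvZl, @dotcvZr).

Lemma dotcv_mulmxr {k l} (M : 'M[R]_(k, l)) u v :
  dotcv u (M *m v) = dotcv (M^T *m u) v.
Proof. by rewrite /dotcv trmx_mul trmxK mulmxA. Qed.

Lemma dotcv_eq0 {k} (u : 'cV[R]_k) : (forall v, dotcv u v = 0) -> u = 0.
Proof.
move=> u_orth; apply/colP => i; rewrite mxE -[RHS](u_orth (delta_mx i 0)).
rewrite dotcvE (bigD1 i) //= mxE !eqxx mulr1 big1 ?addr0 // => j /negPf ji.
by rewrite mxE ji mulr0.
Qed.

Lemma dotcv_complementary {k} (u v : 'cV[R]_k) :
  complementary u v -> dotcv u v = 0.
Proof. by move=> compl; rewrite dotcvE big1 // => i _; case: (compl i). Qed.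

End Dot.

(** * From the quadratic program to the complementarity program *)

Section Reformulation.
Context {R : realType} {n d m : nat}.
Context {Q : 'M[R]_d} {q : 'cV[R]_d} {A : 'M[R]_(d, m)} {b : 'cV[R]_m}.
Context {a lambda : R}.
Hypotheses (Q_sym : Q^T = Q) (a_gt0 : 0 < a) (lambda_gt0 : 0 < lambda).

Lemma qp_objectiveE (beta g h : 'cV[R]_d) :
  qp_objective n Q q a lambda (beta, g, h) =
  2^-1 * dotcv beta (Q *m beta) + dotcv q beta
  + n%:R * \sum_i (g i 0 ^+ 2 / (2 * a) - g i 0 * h i 0 / a + lambda * h i 0).
Proof.
have -> : \sum_i (g i 0 ^+ 2 / (2 * a) - g i 0 * h i 0 / a + lambda * h i 0) =
    dotcv g g / (2 * a) - dotcv g h / a + lambda * dotcv (onescv R d) h.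
  rewrite !dotcvE mulr_sumr !mulr_suml -sumrB -big_split /=.
  by apply: eq_bigr => i _; rewrite /onescv mxE mul1r expr2.
by rewrite /qp_objective; field; rewrite gt_eqF.
Qed.

Lemma mcp_objective_le_qp (beta g h : 'cV[R]_d) :
  qp_feasible A b a lambda (beta, g, h) ->
  mcp_objective n Q q a lambda beta <= qp_objective n Q q a lambda (beta, g, h).
Proof.
move=> [_ h_ge h_geN g_ge0 g_le]; rewrite qp_objectiveE /mcp_objective.
rewrite lerD2l ler_wpM2l // ler_sum // => i _; apply: mcp_le_envelope => //.
- have := h_ge i; have := h_geN i; rewrite !mxE => hN hP.
  by rewrite ler_norml hP andbT lerNl.
- by have := g_ge0 i; rewrite mxE.
- by have := g_le i; rewrite !mxE mulr1.
Qed.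

(** The lift of a solution [beta] is h = |beta| and g = min(|beta|, a lambda),
    where the bound of [mcp_objective_le_qp] is an equality. *)
Lemma qp_solvable :
  (exists beta : 'cV[R]_d, is_global_minimizer (polyhedron A b)
     (mcp_objective n Q q a lambda) beta) ->
  exists beta g h : 'cV[R]_d,
    is_global_minimizer (qp_feasible A b a lambda)
      (qp_objective n Q q a lambda) (beta, g, h).
Proof.
move=> [beta [beta_feas beta_min]].
pose h : 'cV[R]_d := \col_i `|beta i 0|.
pose g : 'cV[R]_d := \col_i Num.min `|beta i 0| (a * lambda).
exists beta, g, h; split=> [|[[beta' g'] h'] feas'].
  split=> // i; rewrite !mxE ?mulr1.
  - exact: ler_norm.
  - by rewrite lerNl lerNnormlW.
  - by rewrite le_min normr_ge0 mulr_ge0 // ltW.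
  - by rewrite ge_min lexx orbT.
have -> : qp_objective n Q q a lambda (beta, g, h) =
          mcp_objective n Q q a lambda beta.
  rewrite qp_objectiveE /mcp_objective; congr (_ + _ * _).
  by apply: eq_bigr => i _; rewrite !mxE; exact: mcp_envelope_attained.
apply: le_trans (mcp_objective_le_qp _ _ _ feas').
by apply: beta_min; case: feas'.
Qed.

Lemma lpcc_feasible_qp {beta g h eta1 eta2 eta3 eta4 rho} :
  lpcc_feasible n Q q A b a lambda (beta, g, h, eta1, eta2, eta3, eta4, rho) ->
  qp_feasible A b a lambda (beta, g, h).
Proof.
move=> [_ [c1 c2 c3 c4 c5]]; split=> i.
- by have [_] := c5 i; rewrite mxE [X in _ + X]mxE subr_ge0.
- by have [_] := c1 i; rewrite mxE [X in _ + X]mxE subr_ge0.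
- by have [_] := c2 i; rewrite !mxE -lerBlDr sub0r.
- by have [_] := c3 i; rewrite mxE.
- by have [_] := c4 i; rewrite mxE [X in _ + X]mxE subr_ge0.
Qed.

(** Pair the three stationarity equations with [beta], [g] and [h], and use
    complementarity to replace each product of a multiplier with its
    constraint by the product with the right-hand side. *)
Lemma lpcc_objectiveE {beta g h eta1 eta2 eta3 eta4 rho} :
  lpcc_feasible n Q q A b a lambda (beta, g, h, eta1, eta2, eta3, eta4, rho) ->
  lpcc_objective n q b a lambda (beta, g, h, eta1, eta2, eta3, eta4, rho) =
  qp_objective n Q q a lambda (beta, g, h).
Proof.
move=> [[stat_beta stat_g stat_h] [c1 c2 c3 c4 c5]].
have := congr1 (dotcv beta) stat_beta.
have := congr1 (dotcv g) stat_g.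
have := congr1 (dotcv h) stat_h.
have := dotcv_complementary _ _ c1; have := dotcv_complementary _ _ c2.
have := dotcv_complementary _ _ c3; have := dotcv_complementary _ _ c4.
have := dotcv_complementary _ _ c5.
rewrite !dotcv_lin !dotcv0r /lpcc_objective /qp_objective.
rewrite dotcv_mulmxr trmxK.
(* Fix one order of the arguments in each product, so that the goal is a linear
   combination of the hypotheses. *)
rewrite !(dotcvC _ eta1) !(dotcvC _ eta2) !(dotcvC _ eta3) (dotcvC h (onescv _ _)).
rewrite (dotcvC beta q) (dotcvC g eta4) (dotcvC h g) (dotcvC beta (A *m rho)).
rewrite (dotcvC eta4 (onescv _ _)) (dotcvC rho b).
lra.
Qed.

(** The quadratic program is put in the form of [kkt], one functional per
    scalar inequality; evaluating the resulting identity on directions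
    supported in a single block separates the three stationarity equations. *)
Lemma lpcc_multipliers {beta g h : 'cV[R]_d} :
  is_global_minimizer (qp_feasible A b a lambda)
    (qp_objective n Q q a lambda) (beta, g, h) ->
  exists (eta1 eta2 eta3 eta4 : 'cV[R]_d) (rho : 'cV[R]_m),
    lpcc_feasible n Q q A b a lambda
      (beta, g, h, eta1, eta2, eta3, eta4, rho).
Proof.
move=> [feas is_min].
pose W : lmodType R := ('cV[R]_d * 'cV[R]_d * 'cV[R]_d)%type.
pose I : finType := ('I_d + 'I_d + ('I_d + 'I_d) + 'I_m)%type.
pose alpha (i : I) (w : W) : R := match i with
  | inl (inl (inl j)) => w.1.1 j 0 - w.2 j 0
  | inl (inl (inr j)) => - w.1.1 j 0 - w.2 j 0
  | inl (inr (inl j)) => - w.1.2 j 0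
  | inl (inr (inr j)) => w.1.2 j 0
  | inr j => (A^T *m w.1.1) j 0
  end.
pose r (i : I) : R := match i with
  | inl (inr (inr _)) => a * lambda
  | inr j => b j 0
  | _ => 0
  end.
(* Gradient of the objective at the minimizer, and half its Hessian form. *)
pose gamma (w : W) := dotcv (Q *m beta + q) w.1.1
  + dotcv ((n%:R / a) *: g - (n%:R / a) *: h) w.1.2
  + dotcv (- (n%:R *: (a^-1 *: g - lambda *: onescv R d))) w.2.
pose kappa (w : W) := 2^-1 * (dotcv w.1.1 (Q *m w.1.1)
  + n%:R / a * dotcv w.1.2 w.1.2 - 2 * n%:R / a * dotcv w.1.2 w.2).
have lin_alpha i : scalar (alpha i).
  move=> t [[x y] z] [[x' y'] z'].
  case: i => [[[]|[]]|] i /=; try by rewrite !mxE; ring.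
  by rewrite mulmxDr -scalemxAr mxE; congr (_ + _); rewrite mxE.
have lin_gamma : scalar gamma.
  move=> t [[x y] z] [[x' y'] z']; rewrite /gamma /= !dotcv_lin; ring.
have expand (w : W) t : qp_objective n Q q a lambda (t *: w + (beta, g, h)) =
    qp_objective n Q q a lambda (beta, g, h) + t * gamma w + t ^+ 2 * kappa w.
  case: w => [[x y] z]; rewrite /gamma /kappa /qp_objective /=.
  rewrite mulmxDr -scalemxAr !dotcv_lin.
  rewrite (dotcv_mulmxr _ beta x) Q_sym (dotcvC x (Q *m beta)).
  rewrite (dotcvC g y) (dotcvC h y); field.
  by rewrite gt_eqF.
have feasE (w : W) :
    qp_feasible A b a lambda w <-> forall i, alpha i w <= r i.
  case: w => [[x y] z]; split.
    move=> [Ax xz xNz y_ge0 y_le] [[[]|[]]|] i /=.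
    - by rewrite subr_le0.
    - by have := xNz i; rewrite !mxE subr_le0.
    - by have := y_ge0 i; rewrite !mxE oppr_le0.
    - by have := y_le i; rewrite !mxE mulr1.
    - exact: Ax.
  move=> le_r; split=> i; rewrite ?mxE.
  - by have := le_r (inr i); rewrite /= mxE.
  - by have := le_r (inl (inl (inl i))); rewrite /= subr_le0.
  - by have := le_r (inl (inl (inr i))); rewrite /= subr_le0.
  - by have := le_r (inl (inr (inl i))); rewrite /= oppr_le0.
  - by have := le_r (inl (inr (inr i))); rewrite mulr1.
have [u [u_ge0 u_compl stat]] : exists u : I -> R,
    [/\ forall i, 0 <= u i, forall i, u i * (r i - alpha i (beta, g, h)) = 0
      & forall w, gamma w + \sum_i u i * alpha i w = 0].
  apply: (kkt alpha r (qp_objective n Q q a lambda : W -> R) gamma kappa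
    ((beta, g, h) : W) lin_alpha lin_gamma expand).
  split; first exact: (feasE (beta, g, h)).1 feas.
  by move=> w w_le; apply: is_min; exact: (feasE w).2 w_le.
have alpha_feas := (feasE (beta, g, h)).1 feas.
pose eta1 : 'cV[R]_d := \col_i u (inl (inl (inl i))).
pose eta2 : 'cV[R]_d := \col_i u (inl (inl (inr i))).
pose eta3 : 'cV[R]_d := \col_i u (inl (inr (inl i))).
pose eta4 : 'cV[R]_d := \col_i u (inl (inr (inr i))).
pose rho : 'cV[R]_m := \col_i u (inr i).
have {}stat x y z :
    dotcv (Q *m beta + q + eta1 - eta2 + A *m rho) x
    + dotcv ((n%:R / a) *: g - (n%:R / a) *: h - eta3 + eta4) y
    + dotcv (- (n%:R *: (a^-1 *: g - lambda *: onescv R d)) - eta1 - eta2) z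
    = 0.
  rewrite -(stat ((x, y), z)) !big_sumType /=.
  have -> : \sum_i u (inl (inl (inl i))) * (x i 0 - z i 0) = dotcv eta1 (x - z).
    by rewrite dotcvE; apply: eq_bigr => i _; rewrite !mxE.
  have -> : \sum_i u (inl (inl (inr i))) * (- x i 0 - z i 0) =
            dotcv eta2 (- x - z).
    by rewrite dotcvE; apply: eq_bigr => i _; rewrite !mxE.
  have -> : \sum_i u (inl (inr (inl i))) * - y i 0 = dotcv eta3 (- y).
    by rewrite dotcvE; apply: eq_bigr => i _; rewrite !mxE.
  have -> : \sum_i u (inl (inr (inr i))) * y i 0 = dotcv eta4 y.
    by rewrite dotcvE; apply: eq_bigr => i _; rewrite !mxE.
  have -> : \sum_i u (inr i) * (A^T *m x) i 0 = dotcv (A *m rho) x.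
    rewrite -[A in RHS]trmxK -dotcv_mulmxr dotcvE.
    by apply: eq_bigr => i _; rewrite [in RHS]mxE.
  by rewrite /gamma /= !dotcv_lin; ring.
exists eta1, eta2, eta3, eta4, rho; split; split.
- by apply: dotcv_eq0 => x; have := stat x 0 0; rewrite !dotcv0r !addr0.
- by apply: dotcv_eq0 => y; have := stat 0 y 0; rewrite !dotcv0r add0r addr0.
- by apply: dotcv_eq0 => z; have := stat 0 0 z; rewrite !dotcv0r !add0r.
- move=> i; have := u_compl (inl (inl (inl i))).
  have := alpha_feas (inl (inl (inl i))); rewrite !mxE /= => feas_i compl_i.
  split; [exact: u_ge0|lra|lra].
- move=> i; have := u_compl (inl (inl (inr i))).
  have := alpha_feas (inl (inl (inr i))); rewrite !mxE /= => feas_i compl_i.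
  split; [exact: u_ge0|lra|lra].
- move=> i; have := u_compl (inl (inr (inl i))).
  have := alpha_feas (inl (inr (inl i))); rewrite !mxE /= => feas_i compl_i.
  split; [exact: u_ge0|lra|lra].
- move=> i; have := u_compl (inl (inr (inr i))).
  have := alpha_feas (inl (inr (inr i))); rewrite !mxE /= => feas_i compl_i.
  split; [exact: u_ge0|lra|lra].
- move=> i; have := u_compl (inr i); have := alpha_feas (inr i).
  rewrite /= => feas_i compl_i.
  have -> : (b - A^T *m beta) i 0 = b i 0 - (A^T *m beta) i 0.
    by rewrite [LHS]mxE; congr (_ + _); rewrite mxE.
  by rewrite /rho mxE; split; [exact: u_ge0|rewrite subr_ge0|].
Qed.

End Reformulation.

(** * Equivalence *)

Theorem theorem3p4 (R : realType) (n d m : nat)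
  (n_ge1 : (1 <= n)%N) (d_ge1 : (1 <= d)%N) (m_lt_d : (m < d)%N)
  (Q : 'M[R]_d) (Q_sym : Q^T = Q) (q : 'cV[R]_d)
  (A : 'M[R]_(d, m)) (A_full_rank : \rank A = m) (b : 'cV[R]_m)
  (Lambda_nonempty : polyhedron A b !=set0)
  (a lambda : R) (a_gt0 : 0 < a) (lambda_gt0 : 0 < lambda)
  (mcp_solvable : exists beta : 'cV[R]_d,
     is_global_minimizer (polyhedron A b) (mcp_objective n Q q a lambda) beta)
  (beta g h : 'cV[R]_d) :
  is_global_minimizer (qp_feasible A b a lambda)
    (qp_objective n Q q a lambda) (beta, g, h)
  <->
  exists (eta1 eta2 eta3 eta4 : 'cV[R]_d) (rho : 'cV[R]_m),
    is_global_minimizer (lpcc_feasible n Q q A b a lambda)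
      (lpcc_objective n q b a lambda)
      (beta, g, h, eta1, eta2, eta3, eta4, rho).
Proof.
split=> [qp_min|].
  have [eta1 [eta2 [eta3 [eta4 [rho feas]]]]] :=
    lpcc_multipliers Q_sym a_gt0 qp_min.
  exists eta1, eta2, eta3, eta4, rho; split=> //.
  move=> [[[[[[[beta' g'] h'] e1] e2] e3] e4] rho'] feas'.
  rewrite (lpcc_objectiveE feas) (lpcc_objectiveE feas'); apply: qp_min.2.
  exact: lpcc_feasible_qp feas'.
move=> [eta1 [eta2 [eta3 [eta4 [rho [feas lpcc_min]]]]]].
split; first exact: lpcc_feasible_qp feas.
have [beta0 [g0 [h0 qp_min]]] := qp_solvable a_gt0 lambda_gt0 mcp_solvable.
have [e1 [e2 [e3 [e4 [rho0 feas0]]]]] :=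
  lpcc_multipliers Q_sym a_gt0 qp_min.
move=> y y_feas; apply: le_trans (qp_min.2 y y_feas).
by have := lpcc_min _ feas0; rewrite (lpcc_objectiveE feas) (lpcc_objectiveE feas0).
Qed.
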